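(* Let $E$ be a symmetric space on $I$ (with the Fatou property) and let $x\in E$ with $x^*(\infty)=0$. If $x$ is an $H_g$ point in $E$, then $x$ is a point of order continuity in $E$.
   Context: Let $\mu$ be Lebesgue measure on $I=[0,\alpha)$, where $\alpha=1$ or $\alpha=\infty$, and let $L^0$ be the set of (equivalence classes of) extended real valued Lebesgue measurable functions on $I$. A Banach function space $E$ is a Banach lattice $(E,\|\cdot\|_E)$ which is a sublattice of $L^0$ such that: (1) if $x\in L^0$, $y\in E$ and $|x|\le|y|$ a.e., then $x\in E$ and $\|x\|_E\le\|y\|_E$; (2) there exists a strictly positive $x\in E$. $E^+=\{x\in E: x\ge 0\}$. $E$ has the Fatou property if whenever $(x_n)\subset E^+$, $\sup_n\|x_n\|_E<\infty$ and $x_n\uparrow x\in L^0$, then $x\in E$ and $\|x_n\|_E\uparrow\|x\|_E$. Standing assumption: $E$ has the Fatou property. For $x\in L^0$: the distribution function is $d_x(\lambda)=\mu\{s\in I:|x(s)|>\lambda\}$, $\lambda\ge0$; the decreasing rearrangement is $x^*(t)=\inf\{\lambda>0:d_x(\lambda)\le t\}$, $t\ge0$. Convention: $x^*(\infty)=\lim_{t\to\infty}x^*(t)$ if $\alpha=\infty$, and $x^*(\infty)=0$ if $\alpha=1$. A Banach function space $E$ is symmetric if whenever $x\in L^0$, $y\in E$ and $d_x=d_y$, then $x\in E$ and $\|x\|_E=\|y\|_E$. Functions $f_n$ converge to $f$ globally in measure if $\mu\{t\in I:|f_n(t)-f(t)|>\varepsilon\}\to0$ for every $\varepsilon>0$.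 $x\in E$ is an $H_g$ point in $E$ if for every sequence $(x_n)\subset E$ such that $x_n\to x$ globally in measure and $\|x_n\|_E\to\|x\|_E$ we have $\|x_n-x\|_E\to0$. $x\in E$ is a point of order continuity of $E$ if for every sequence $(x_n)\subset E^+$ with $x_n\le|x|$ and $x_n\to0$ a.e. we have $\|x_n\|_E\to0$. *)

(* Defs.v *)
From HB Require Import structures.
From mathcomp Require Import all_boot all_order all_algebra.
From mathcomp Require Import all_classical all_reals all_analysis measurable_realfun.

Set Implicit Arguments.
Unset Strict Implicit.
Unset Printing Implicit Defensive.

Import Order.TTheory GRing.Theory Num.Theory.
Import numFieldNormedType.Exports.
Local Open Scope classical_set_scope.
Local Open Scope ring_scope.
Local Open Scope ereal_scope.

(* The elements of L^0(I) are represented by functions T -> \bar R of which    *)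
(* only the restriction to I matters; equality, order and convergence are      *)
(* taken mu-a.e. on I, so a subset of L^0 and a norm on it are given on        *)
(* representatives.                                                            *)
Section function_spaces.
Context {d : measure_display} {T : measurableType d} {R : realType}.
Variables (mu : {measure set T -> \bar R}) (I : set T).

Definition L0 : set (T -> \bar R) := [set x : T -> \bar R | measurable_fun I x].

(* bfs_ideal makes membership and the norm invariant under a.e. equality, and  *)
(* contains the compatibility of the norm with the order.                      *)
(* bfs_fin is what makes the linear operations well defined on classes: in     *)
(* \bar R the sum of +oo and -oo is a junk value. Values of bfs_norm outside   *)
(* of the space are irrelevant.                                                *)
Record bfs := BFS {
  bfs_set : set (T -> \bar R) ;
  bfs_norm : (T -> \bar R) -> R ;
  bfs_L0 : bfs_set `<=` L0 ;
  bfs_fin : forall x, bfs_set x ->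
    \forall t \ae mu, I t -> x t \is a fin_num ;
  bfs0 : bfs_set (cst 0) ;
  bfsD : forall x y, bfs_set x -> bfs_set y -> bfs_set (x \+ y) ;
  bfsZ : forall (a : R) x, bfs_set x -> bfs_set (fun t => a%:E * x t) ;
  bfs_max : forall x y, bfs_set x -> bfs_set y ->
    bfs_set (fun t => maxe (x t) (y t)) ;
  bfs_min : forall x y, bfs_set x -> bfs_set y ->
    bfs_set (fun t => mine (x t) (y t)) ;
  bfs_norm_ge0 : forall x, bfs_set x -> (0 <= bfs_norm x)%R ;
  bfs_norm_eq0 : forall x, bfs_set x -> bfs_norm x = 0%R ->
    ae_eq mu I x (cst 0) ;
  bfs_normZ : forall (a : R) x, bfs_set x ->
    bfs_norm (fun t => a%:E * x t) = (`|a| * bfs_norm x)%R ;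
  bfs_normD : forall x y, bfs_set x -> bfs_set y ->
    (bfs_norm (x \+ y)%E <= bfs_norm x + bfs_norm y)%R ;
  bfs_complete : forall x_ : nat -> T -> \bar R, (forall n, bfs_set (x_ n)) ->
    (forall e : R, (0 < e)%R -> exists N : nat, forall m n : nat,
      (N <= m)%N -> (N <= n)%N -> (bfs_norm (x_ m \- x_ n)%E < e)%R) ->
    exists2 x, bfs_set x & bfs_norm (x_ n \- x) @[n --> \oo] --> (0 : R)%R ;
  bfs_ideal : forall x y, L0 x -> bfs_set y ->
    (\forall t \ae mu, I t -> `|x t| <= `|y t|) ->
    bfs_set x /\ (bfs_norm x <= bfs_norm y)%R ;
  bfs_weak_unit : exists2 x, bfs_set x & \forall t \ae mu, I t -> 0 < x t }.

Definition bfs_pos (E : bfs) : set (T -> \bar R) :=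
  [set x | bfs_set E x /\ \forall t \ae mu, I t -> 0 <= x t].

Definition fatou_property (E : bfs) :=
  forall (x_ : nat -> T -> \bar R) (x : T -> \bar R),
    (forall n, bfs_pos E (x_ n)) ->
    has_ubound (range (fun n => bfs_norm E (x_ n))) ->
    L0 x ->
    (\forall t \ae mu, I t ->
      nondecreasing_seq (x_ ^~ t) /\ x_ n t @[n --> \oo] --> x t) ->
    [/\ bfs_set E x, nondecreasing_seq (fun n => bfs_norm E (x_ n)) &
        bfs_norm E (x_ n) @[n --> \oo] --> bfs_norm E x].

Definition distr_fun (x : T -> \bar R) (l : R) : \bar R :=
  mu (I `&` [set t | l%:E < `|x t|]).

Definition rearrangement (x : T -> \bar R) (t : R) : \bar R :=
  ereal_inf [set l%:E | l in [set l : R | (0 < l)%R /\ distr_fun x l <= t%:E]].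

Definition symmetric_bfs (E : bfs) :=
  forall x y, L0 x -> bfs_set E y ->
    (forall l : R, (0 <= l)%R -> distr_fun x l = distr_fun y l) ->
    bfs_set E x /\ bfs_norm E x = bfs_norm E y.

Definition cvg_globally_in_measure
    (x_ : nat -> T -> \bar R) (x : T -> \bar R) :=
  forall e : R, (0 < e)%R ->
    mu (I `&` [set t | e%:E < `|x_ n t - x t|]) @[n --> \oo] --> 0.

Definition Hg_point (E : bfs) (x : T -> \bar R) :=
  bfs_set E x /\
  forall x_ : nat -> T -> \bar R, (forall n, bfs_set E (x_ n)) ->
    cvg_globally_in_measure x_ x ->
    bfs_norm E (x_ n) @[n --> \oo] --> bfs_norm E x ->
    bfs_norm E (x_ n \- x) @[n --> \oo] --> (0 : R)%R.

Definition order_continuity_point (E : bfs) (x : T -> \bar R) :=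
  bfs_set E x /\
  forall x_ : nat -> T -> \bar R, (forall n, bfs_pos E (x_ n)) ->
    (forall n, \forall t \ae mu, I t -> x_ n t <= `|x t|) ->
    (\forall t \ae mu, I t -> x_ n t @[n --> \oo] --> 0) ->
    bfs_norm E (x_ n) @[n --> \oo] --> (0 : R)%R.

End function_spaces.

(* The real line with the sigma-algebra of Lebesgue (rather than Borel)        *)
(* measurable sets, i.e. the domain of completed_lebesgue_measure.             *)
Notation lebesgueType R :=
  (caratheodory_type (R := R) (wlength (R := R) idfun)^*%mu).

Definition interval0 {R : realType} (alpha : \bar R) : set (lebesgueType R) :=
  [set t : R | (0 <= t)%R /\ t%:E < alpha].

Definition rearrangement_infty {R : realType} (alpha : \bar R)
    (x : lebesgueType R -> \bar R) : \bar R :=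
  if alpha == +oo then
    lim (rearrangement (@completed_lebesgue_measure R) (interval0 alpha) x t
           @[t --> +oo%R])
  else 0.

(* Main.v *)
(** Given 0 <= x_n <= |x| with x_n -> 0 a.e., let y_n = sup_(k >= n) x_k and
    shrink x towards 0 by y_n, i.e. let z_n = x - sgn(x) y_n. Then
    |z_n| = |x| - y_n increases to |x|, so ||z_n|| -> ||x|| by the Fatou
    property. The condition x^*(oo) = 0 says that {|x| > e} has finite measure
    for every e > 0; these sets contain {y_n > e}, so continuity from above
    gives z_n -> x globally in measure. As x is an H_g point,
    ||x_n|| <= ||y_n|| = ||z_n - x|| -> 0. *)
Require Import Defs.
From mathcomp Require Import all_boot all_order all_algebra.
From mathcomp Require Import all_classical all_reals all_analysis.
From mathcomp Require Import measurable_realfun.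

Set Implicit Arguments.
Unset Strict Implicit.
Unset Printing Implicit Defensive.

Import Order.TTheory GRing.Theory Num.Theory.
Import numFieldNormedType.Exports.
Local Open Scope classical_set_scope.
Local Open Scope ring_scope.
Local Open Scope ereal_scope.

Section general_measure.
Context {d : measure_display} {T : measurableType d} {R : realType}.
Variables (mu : {measure set T -> \bar R}) (I : set T).
Hypothesis mI : measurable I.

Lemma ae_le_measure (A B : set T) : measurable A -> measurable B ->
  (\forall t \ae mu, A t -> B t) -> mu A <= mu B.
Proof.
move=> mA mB [N [mN N0 sN]].
rewrite -(measureU0 mB mN N0); apply: le_measure; rewrite ?inE//.
  exact: measurableU.
move=> t At; have [Nt|nNt] := pselect (N t); [by right|left].
by apply: contrapT => nBt; apply/nNt/sN => /(_ At).
Qed.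

(** Continuity from above along the superlevel sets, which decrease because [y_] does; [fin]
    supplies the set of finite measure that it requires. *)
Lemma nonincreasing_cvg_measure_gt (y_ : nat -> T -> \bar R) (e : R) :
  (0 < e)%R ->
  (forall n, measurable_fun I (y_ n)) ->
  (forall t, {homo y_ ^~ t : n m / (n <= m)%N >-> m <= n}) ->
  (\forall t \ae mu, I t -> y_ n t @[n --> \oo] --> 0) ->
  mu (I `&` [set t | e%:E < y_ 0%N t]) < +oo ->
  mu (I `&` [set t | e%:E < y_ n t]) @[n --> \oo] --> 0.
Proof.
move=> e0 my ydec y0 fin.
pose G n := I `&` [set t | e%:E < y_ n t].
have mG n : measurable (G n) by exact: emeasurable_fun_o_infty.
have mbG : measurable (\bigcap_n G n) by exact: bigcapT_measurable.
have <- : mu (\bigcap_n G n) = 0.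
  (* The intersection is compared with the empty set: at almost every point of it, all [y_ n t]
     exceed [e], so their limit 0 would be at least [e]. *)
  apply/eqP; rewrite -measure_le0 -(measure0 mu); apply: ae_le_measure => //.
  apply: filterS y0 => t ycvg Gt.
  have [It _] := Gt 0%N Logic.I.
  have : e%:E <= 0 :> \bar R.
    rewrite -(cvg_lim _ (ycvg It))//.
    apply: lime_ge; first exact: cvgP (ycvg It).
    by apply: nearW => n; have [_ /ltW] := Gt n Logic.I.
  by rewrite leNgt lte_fin e0.
apply: nonincreasing_cvg_mu => // n m nm; apply/subsetPset => t [It /= et].
by split => //=; exact: lt_le_trans et (ydec _ _ _ nm).
Qed.

(** The finiteness of [distr_fun] is the form in which the condition at infinity enters; it covers
    both choices of the interval. *)
Lemma Hg_order_continuity_point (E : bfs mu I) (x : T -> \bar R) :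
  fatou_property E ->
  (forall e : R, (0 < e)%R -> distr_fun mu I x e < +oo) ->
  Hg_point E x -> order_continuity_point E x.
Proof.
move=> fatou xfin [Ex Hgx]; split=> // x_ x_pos x_le x_0.
have mx : measurable_fun I x := bfs_L0 Ex.
have mx_ n : measurable_fun I (x_ n) := bfs_L0 (x_pos n).1.
pose y_ n t := esups (x_ ^~ t) n.
have my n : measurable_fun I (y_ n) by exact: measurable_fun_esups.
have ydec t : {homo y_ ^~ t : n m / (n <= m)%N >-> m <= n}.
  exact: nonincreasing_esups.
have y_ge n t : x_ n t <= y_ n t.
  by rewrite /y_ /esups; apply: ereal_sup_ubound; exists n => /=.
(* All pointwise facts are gathered off a single null set. Finiteness matters because subtraction in
   [\bar R] is reliable only there. *)
have y_ok : \forall t \ae mu, I t ->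
    [/\ x t \is a fin_num, forall n, 0 <= x_ n t,
        forall n, y_ n t \is a fin_num,
        forall n, 0 <= y_ n t <= `|x t| & y_ n t @[n --> \oo] --> 0].
  have /ae_foralln x_itv : forall n, \forall t \ae mu, I t ->
      0 <= x_ n t <= `|x t|.
    move=> n; apply: filterS2 (x_pos n).2 (x_le n) => t h0 hx It.
    by rewrite h0// hx.
  apply: filterS3 (bfs_fin Ex) x_0 x_itv => t xf cx h It.
  have h0 n : 0 <= x_ n t by have /andP[] := h n It.
  have hx n : x_ n t <= `|x t| by have /andP[] := h n It.
  have y0x n : 0 <= y_ n t <= `|x t|.
    rewrite (le_trans (h0 n) (y_ge n t))/=.
    by apply: ge_ereal_sup => _ [k _ <-]; exact: hx.
  split => //; [exact: xf| |exact: cvg_esups (cx It)].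
  move=> n; have /andP[yn0 ynx] := y0x n.
  rewrite ge0_fin_numE//; apply: le_lt_trans ynx _.
  by rewrite ltey_eq -?fin_numE abse_fin_num xf.
(* The test replaces sgn(x); where [x t] is 0, almost everywhere [y_ n t] is 0 too, so the choice of
   branch is immaterial. *)
pose z_ n t := if 0 <= x t then x t - y_ n t else x t + y_ n t.
have mz n : measurable_fun I (z_ n).
  apply: measurable_fun_if => //.
  - apply: (measurable_fun_bool true) => //.
    exact: emeasurable_fun_c_infty.
  - apply: measurable_funS (emeasurable_funB mx (my n)) => //; exact: subIsetl.
  - apply: measurable_funS (emeasurable_funD mx (my n)) => //; exact: subIsetl.
(* Since [y_ n t] is at most the modulus of [x t], the shrinking never crosses 0. *)
have absz : \forall t \ae mu, I t -> forall n, `|z_ n t| = `|x t| - y_ n t.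
  apply: filterS y_ok => t h It n.
  have [xf _ yf yx _] := h It.
  move: xf (yf n) (yx n); rewrite /z_.
  case: (x t) => [r| |]//; case: (y_ n t) => [s| |]// _ _.
  rewrite /= !lee_fin => /andP[s0 sr]; case: ifPn => r0.
    rewrite (ger0_norm r0) in sr *.
    by rewrite -EFinD abse_EFin ger0_norm// subr_ge0.
  move: r0; rewrite -ltNge => r0; rewrite (ltr0_norm r0) in sr *.
  by rewrite -!EFinD abse_EFin ler0_norm ?opprD// -lerBrDr sub0r -lerNr.
have zBx : \forall t \ae mu, I t -> forall n, `|z_ n t - x t| = y_ n t.
  apply: filterS y_ok => t h It n.
  have [xf _ yf yx _] := h It.
  move: xf (yf n) (yx n); rewrite /z_.
  case: (x t) => [r| |]//; case: (y_ n t) => [s| |]// _ _.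
  rewrite /= !lee_fin => /andP[s0 sr]; case: ifPn => _ /=.
    by rewrite addrAC subrr sub0r normrN ger0_norm.
  by rewrite addrAC subrr add0r ger0_norm.
have Ez n : bfs_set E (z_ n) /\ (bfs_norm E (z_ n) <= bfs_norm E x)%R.
  apply: bfs_ideal (mz n) Ex _; apply: filterS2 y_ok absz => t h hz It.
  have [xf _ yf yx _] := h It; rewrite hz// leeBlDr// leeDl//.
  by have /andP[] := yx n.
have mabs u : measurable_fun I u -> measurable_fun I (abse \o u).
  by move=> mfu; exact: measurableT_comp.
(* The ideal property in both directions, as u and |u| have the same modulus. This makes the Fatou
   property, stated for nonnegative functions, applicable to [z_]. *)
have absE u : bfs_set E u ->
    bfs_set E (abse \o u) /\ bfs_norm E (abse \o u) = bfs_norm E u.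
  move=> Eu; have mfu := bfs_L0 Eu.
  have mafu : L0 I (abse \o u) by exact: mabs.
  have [Eau le1] : bfs_set E (abse \o u) /\
      (bfs_norm E (abse \o u) <= bfs_norm E u)%R.
    by apply: bfs_ideal mafu Eu _; apply: aeW => t It /=; rewrite abse_id.
  have [_ le2] : bfs_set E u /\ (bfs_norm E u <= bfs_norm E (abse \o u))%R.
    by apply: bfs_ideal mfu Eau _; apply: aeW => t It /=; rewrite abse_id.
  by split => //; apply/eqP; rewrite eq_le le1.
have z_norm : bfs_norm E (z_ n) @[n --> \oo] --> bfs_norm E x.
  have [] := fatou (fun n => abse \o z_ n) (abse \o x).
  - move=> n; split; first exact: (absE _ (Ez n).1).1.
    by apply: aeW => t It /=.
  - exists (bfs_norm E x) => _ [n _ <-].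
    by rewrite (absE _ (Ez n).1).2; exact: (Ez n).2.
  - exact: mabs.
  - apply: filterS2 y_ok absz => t h hz It; have [xf _ yf yx ycvg] := h It.
    split.
      move=> n m nm /=; rewrite !hz// leeB//.
      exact: ydec.
    rewrite /= (_ : (fun n => _) = (fun n => `|x t| - y_ n t)); last first.
      by apply/funext => n; rewrite hz.
    rewrite -[X in _ --> X]sube0; apply: cvgeB => //.
      by rewrite fin_num_adde_defl.
    exact: cvg_cst.
  - move=> _ _; rewrite (absE _ Ex).2.
    by under eq_fun do rewrite (absE _ (Ez _).1).2.
have z_meas : cvg_globally_in_measure mu I z_ x.
  move=> e e0.
  (* The two sets agree only up to a null set, so their measures are compared by two almost
     everywhere inclusions. *)
  have zy n : mu (I `&` [set t | e%:E < `|z_ n t - x t|]) =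
              mu (I `&` [set t | e%:E < y_ n t]).
    have m1 : measurable (I `&` [set t | e%:E < `|z_ n t - x t|]).
      apply: emeasurable_fun_o_infty => //.
      by apply: mabs; exact: emeasurable_funB.
    have m2 : measurable (I `&` [set t | e%:E < y_ n t]).
      exact: emeasurable_fun_o_infty.
    by apply/eqP; rewrite eq_le !ae_le_measure//;
      apply: filterS zBx => t h [It /=]; rewrite h.
  under eq_fun do rewrite zy.
  apply: nonincreasing_cvg_measure_gt => //.
    by apply: filterS y_ok => t h /h[].
  (* Finiteness at index 0: almost everywhere [y_ 0] is dominated by |x|. *)
  apply: le_lt_trans (xfin _ e0); apply: ae_le_measure.
  - exact: emeasurable_fun_o_infty.
  - by apply: emeasurable_fun_o_infty => //; exact: mabs.
  apply: filterS y_ok => t h [It /= ey]; split => //=.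
  have [_ _ _ yx _] := h It; apply: lt_le_trans ey _.
  by have /andP[] := yx 0%N.
(* The difference is rewritten as a sum with -1 times [x], to use closure under sums and
   scalings. *)
have EzBx n : bfs_set E (z_ n \- x).
  have := bfsD (Ez n).1 (bfsZ (-1) Ex).
  by under [X in _ X -> _]eq_fun do rewrite mulN1e.
have zBx0 := Hgx _ (fun n => (Ez n).1) z_meas z_norm.
(* By the ideal property, the norm of [x_ n] lies between 0 and that of [z_ n \- x], whose modulus
   is [y_ n] almost everywhere. *)
apply: (squeeze_cvgr _ (cvg_cst _) zBx0); apply: nearW => n.
rewrite bfs_norm_ge0/=; last exact: (x_pos n).1.
suff /(bfs_ideal (mx_ n) (EzBx n))[] : \forall t \ae mu, I t ->
    `|x_ n t| <= `|(z_ n \- x) t| by [].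
apply: filterS2 y_ok zBx => t h hz It; have [_ x0 _ _ _] := h It.
by rewrite /= hz// gee0_abs.
Qed.

Lemma rearrangement_nonincreasing (x : T -> \bar R) :
  {homo rearrangement mu I x : s t / (s <= t)%R >-> t <= s}.
Proof.
move=> s t st; apply: ereal_inf_le_tmp => _ [l [l0 xl] <-].
by exists l => //; split => //; apply: le_trans xl _; rewrite lee_fin.
Qed.

(** By monotonicity the limit is the infimum of the rearrangement. Being 0, it yields some t with
    x^*(t) < e, hence a level l < e whose distribution value is at most t; the value at e is no
    larger. *)
Lemma distr_fun_lty (x : T -> \bar R) (e : R) : measurable_fun I x ->
  lim (rearrangement mu I x t @[t --> +oo%R]) = 0 ->
  (0 < e)%R -> distr_fun mu I x e < +oo.
Proof.
move=> mx; have cr := nonincreasing_cvge (@rearrangement_nonincreasing x).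
rewrite (cvg_lim _ cr)// => inf0 e0.
have : ereal_inf (range (rearrangement mu I x)) < e%:E by rewrite inf0 lte_fin.
move=> /ereal_inf_lt[_ [t _ <-]] /ereal_inf_lt[_ [l [l0 xl] <-]].
rewrite lte_fin => le.
apply: le_lt_trans (ltry t); apply: le_trans xl.
have mabs (r : R) : measurable (I `&` [set u | r%:E < `|x u|]).
  by apply: emeasurable_fun_o_infty => //; exact: measurableT_comp.
apply: le_measure; rewrite ?inE//.
move=> u [Iu /= eu]; split => //=; apply: lt_trans eu.
by rewrite lte_fin.
Qed.

End general_measure.

Lemma measurable_interval0 (R : realType) (alpha : \bar R) :
  measurable (interval0 alpha).
Proof.
(* Borel sets are Carathéodory measurable, so it suffices to argue in the Borel sigma-algebra. *)
suff : (measurable : set (set (measurableTypeR R))) (interval0 alpha).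
  exact: sub_caratheodory.
(* Cutting a half-line by the preimage of a ray of [\bar R] treats finite and infinite [alpha]
   together. *)
have -> : interval0 alpha =
    `[0%R, +oo[%classic `&` (@EFin R @^-1` [set z : \bar R | z < alpha]).
  by apply/seteqP; split => t /=; rewrite in_itv/= andbT.
apply: measurableI; first exact: measurable_itv.
by rewrite -[X in measurable X]setTI; apply: EFin_measurable => //;
  rewrite -set_itvNyo; exact: emeasurable_itv.
Qed.

Theorem proposition4p11 (R : realType) (alpha : \bar R)
  (halpha : alpha = 1%:E \/ alpha = +oo%E)
  (E : bfs (@completed_lebesgue_measure R) (interval0 alpha))
  (hsym : symmetric_bfs E) (hfatou : fatou_property E)
  (x : lebesgueType R -> \bar R) (hEx : bfs_set E x)
  (hx : rearrangement_infty alpha x = 0%E) :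
  Hg_point E x -> order_continuity_point E x.
Proof.
have mI := @measurable_interval0 R alpha.
apply: Hg_order_continuity_point => // e e0.
have mx : measurable_fun (interval0 alpha) x := bfs_L0 hEx.
move: hx; rewrite /rearrangement_infty; case: ifPn => [_ hx|].
  exact: distr_fun_lty hx e0.
case: halpha => [alpha1 _ _|->]; last by rewrite eqxx.
(* For [alpha] equal to 1, every superlevel set lies in an interval of measure 1. *)
apply: (@le_lt_trans _ _ (completed_lebesgue_measure (interval0 alpha))).
  apply: le_measure; rewrite ?inE//.
  by apply: emeasurable_fun_o_infty => //; exact: measurableT_comp.
have -> : interval0 alpha = `[0%R, 1%R[%classic.
  apply/seteqP; split => t;
    by rewrite /interval0/= in_itv/= alpha1 lte_fin => /andP.
(* On this Borel set the completed measure is convertible to [lebesgue_measure], whose value on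
   intervals is known. *)
change (lebesgue_measure (`[0%R, 1%R[%classic : set (measurableTypeR R)) < +oo).
by rewrite lebesgue_measure_itv/= lte_fin ltr01 sube0 ltry.
Qed.
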